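(* Let $\mathbf{ICMon}$ be the category of inverse commutative monoids and let $\mathbf{ECMon}$ be its full subcategory of idempotent commutative monoids. Let $\mathcal F$ be the full subcategory of $\mathbf{ICMon}$ consisting of torsion-free inverse monoids, that is, inverse commutative monoids $M$ (written multiplicatively) such that for all $x\in M$, if $x^n=1$ for some positive integer $n$, then $x=1$. The subcategory $\mathcal F$ is both $0$-torsion-free (i.e. $\mathcal Z$-torsion-free with $\mathcal Z$ the class of zero objects) and $\mathcal Z$-torsion-free with $\mathcal Z=\mathbf{ECMon}$ in $\mathbf{ICMon}$.
   Context: A commutative monoid $M$ is an inverse commutative monoid if for every $x\in M$ there exists $x^{-1}\in M$ with $xx^{-1}x=x$ and $x^{-1}xx^{-1}=x^{-1}$. Morphisms are monoid homomorphisms. An idempotent commutative monoid is a commutative monoid all of whose elements are idempotent. Let $\mathcal Z$ be a full replete subcategory of a category $\mathcal C$. A morphism is $\mathcal Z$-trivial if it factors through an object of $\mathcal Z$. A $\mathcal Z$-kernel of $f\colon A\to B$ is a pair $(K,k\colon K\to A)$ such that $f\circ k$ is $\mathcal Z$-trivial and every $x\colon X\to A$ with $f\circ x$ $\mathcal Z$-trivial factors uniquely as $x=k\circ x'$; $\mathcal Z$-cokernels are dual. A sequence $A\xrightarrow{f}B\xrightarrow{g}C$ is $\mathcal Z$-exact if $(A,f)$ is the $\mathcal Z$-kernel of $g$ and $(C,g)$ is the $\mathcal Z$-cokernel of $f$. A $\mathcal Z$-torsion theory on $\mathcal C$ is a pair $(\mathcal T,\mathcal F)$ of full replete subcategories such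 that every morphism $A\to B$ with $A\in\mathcal T$, $B\in\mathcal F$ is $\mathcal Z$-trivial, and for every object $X$ there is a $\mathcal Z$-exact sequence $A\to X\to B$ with $A\in\mathcal T$ and $B\in\mathcal F$. $\mathcal F$ is $\mathcal Z$-torsion-free if there exists $\mathcal T$ such that $(\mathcal T,\mathcal F)$ is a $\mathcal Z$-torsion theory. When $\mathcal Z$ is the class of zero objects of a pointed category these are the usual kernels, cokernels and torsion theories. *)

(* Defs.v *)
From HB Require Import structures.
From mathcomp Require Import all_boot.
From mathcomp Require Import boolp.

Set Implicit Arguments.
Unset Strict Implicit.
Unset Printing Implicit Defensive.

Import Algebra.

Local Open Scope group_scope.

Declare Scope cat_scope.
Delimit Scope cat_scope with cat.

Record category := Category {
  ob :> Type;
  hom : ob -> ob -> Type;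
  idm : forall A : ob, hom A A;
  comp : forall A B C : ob, hom B C -> hom A B -> hom A C;
  comp1m : forall (A B : ob) (f : hom A B), comp (idm B) f = f;
  compm1 : forall (A B : ob) (f : hom A B), comp f (idm A) = f;
  compA : forall (A B C D : ob) (h : hom C D) (g : hom B C) (f : hom A B),
    comp h (comp g f) = comp (comp h g) f }.

Arguments idm {c} A.

Notation "g '\oc' f" := (comp g f)
  (at level 50, left associativity) : cat_scope.

Local Open Scope cat_scope.

Definition isomorphic (C : category) (A B : C) : Prop :=
  exists (f : hom A B) (g : hom B A), g \oc f = idm A /\ f \oc g = idm B.

Record full_replete_subcategory (C : category) := FullRepleteSubcategory {
  in_subcat :> C -> Prop;
  replete : forall A B : C, isomorphic A B -> in_subcat A -> in_subcat B }.

Section Torsion.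
Variables (C : category) (Z : full_replete_subcategory C).

Definition Ztrivial (A B : C) (f : hom A B) : Prop :=
  exists (O : C) (p : hom A O) (q : hom O B), Z O /\ f = q \oc p.

Definition is_Zkernel (A B K : C) (f : hom A B) (k : hom K A) : Prop :=
  Ztrivial (f \oc k) /\
  forall (X : C) (x : hom X A), Ztrivial (f \oc x) ->
    exists! x' : hom X K, x = k \oc x'.

Definition is_Zcokernel (A B Q : C) (f : hom A B) (q : hom B Q) : Prop :=
  Ztrivial (q \oc f) /\
  forall (X : C) (x : hom B X), Ztrivial (x \oc f) ->
    exists! x' : hom Q X, x = x' \oc q.

Definition Zexact (A B D : C) (f : hom A B) (g : hom B D) : Prop :=
  is_Zkernel g f /\ is_Zcokernel f g.

Definition Ztorsion_theory (T F : full_replete_subcategory C) : Prop :=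
  (forall (A B : C) (f : hom A B), T A -> F B -> Ztrivial f) /\
  (forall X : C, exists (A B : C) (f : hom A X) (g : hom X B),
     [/\ T A, F B & Zexact f g]).

Definition Ztorsion_free (F : full_replete_subcategory C) : Prop :=
  exists T : full_replete_subcategory C, Ztorsion_theory T F.

End Torsion.

Section ZeroObjects.
Variable C : category.

Definition is_initial (O : C) : Prop :=
  forall X : C, exists f : hom O X, forall g : hom O X, g = f.

Definition is_terminal (O : C) : Prop :=
  forall X : C, exists f : hom X O, forall g : hom X O, g = f.

Definition is_zero_object (O : C) : Prop := is_initial O /\ is_terminal O.

Definition pointed : Prop := exists O : C, is_zero_object O.

Lemma is_zero_object_replete (A B : C) :
  isomorphic A B -> is_zero_object A -> is_zero_object B.
Proof.
move=> [f [g [gf fg]]] [iA tA]; split=> X.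
  have [h hP] := iA X; exists (h \oc g) => k.
  by rewrite -(hP (k \oc f)) -compA fg compm1.
have [h hP] := tA X; exists (f \oc h) => k.
by rewrite -(hP (g \oc k)) compA fg comp1m.
Qed.

Definition zero_objects : full_replete_subcategory C :=
  FullRepleteSubcategory is_zero_object_replete.

End ZeroObjects.

(* Existence of an inverse is a mere property: in a commutative monoid such an
   inverse is unique and preserved by monoid homomorphisms. The choice structure
   carried by a monoidType is invisible to morphisms, and classically every type
   has one, so it does not restrict the category. *)
Record icmon := ICMonoid {
  icmon_sort :> monoidType;
  icmon_mulC : forall x y : icmon_sort, x * y = y * x;
  icmon_inverse : forall x : icmon_sort,
    exists y : icmon_sort, x * y * x = x /\ y * x * y = y }.

Lemma umagma_morphism_ext (M N : baseUMagmaType)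
  (f g : UMagmaMorphism.type M N) : f =1 g -> f = g.
Proof.
case: f g => [f [[fM] [f1]]] [g [[gM] [g1]]] /= /funext fg.
subst g; congr UMagmaMorphism.Pack.
by rewrite (Prop_irrelevance fM gM) (Prop_irrelevance f1 g1).
Qed.

Section ICMon.

Definition icmon_hom (M N : icmon) : Type := UMagmaMorphism.type M N.

Definition icmon_id (M : icmon) : icmon_hom M M := idfun.

Definition icmon_comp (M N P : icmon) (g : icmon_hom N P) (f : icmon_hom M N)
  : icmon_hom M P := g \o f.

Lemma icmon_comp1m (M N : icmon) (f : icmon_hom M N) :
  icmon_comp (icmon_id N) f = f.
Proof. exact: umagma_morphism_ext. Qed.

Lemma icmon_compm1 (M N : icmon) (f : icmon_hom M N) :
  icmon_comp f (icmon_id M) = f.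
Proof. exact: umagma_morphism_ext. Qed.

Lemma icmon_compA (M N P Q : icmon) (h : icmon_hom P Q) (g : icmon_hom N P)
  (f : icmon_hom M N) :
  icmon_comp h (icmon_comp g f) = icmon_comp (icmon_comp h g) f.
Proof. exact: umagma_morphism_ext. Qed.

Definition ICMon : category := Category icmon_comp1m icmon_compm1 icmon_compA.

End ICMon.

Lemma ICMon_iso (M N : ICMon) : isomorphic M N ->
  exists (f : icmon_hom M N) (g : icmon_hom N M), cancel f g /\ cancel g f.
Proof.
move=> [f [g [gf fg]]]; exists f, g; split=> x.
  exact: (congr1 (fun h : icmon_hom M M => h x) gf).
exact: (congr1 (fun h : icmon_hom N N => h x) fg).
Qed.

Definition idempotent_monoid (M : monoidType) : Prop := forall x : M, x * x = x.

Definition torsion_free_monoid (M : monoidType) : Prop :=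
  forall (x : M) (n : nat), (0 < n)%N -> x ^+ n = 1 -> x = 1.

Lemma idempotent_replete (M N : ICMon) :
  isomorphic M N -> idempotent_monoid M -> idempotent_monoid N.
Proof.
move=> /ICMon_iso[f [g [_ gK]]] idM x.
by rewrite -(gK x) -gmulfM idM.
Qed.

Lemma torsion_free_replete (M N : ICMon) :
  isomorphic M N -> torsion_free_monoid M -> torsion_free_monoid N.
Proof.
move=> /ICMon_iso[f [g [_ gK]]] tfM x n n_gt0 xn1.
rewrite -(gK x) (tfM (g x) n n_gt0) ?gmulf1//.
by rewrite -gmulfXn xn1 gmulf1.
Qed.

Definition ECMon : full_replete_subcategory ICMon :=
  FullRepleteSubcategory idempotent_replete.

Definition TFICMon : full_replete_subcategory ICMon :=
  FullRepleteSubcategory torsion_free_replete.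

Lemma unit_mulA : associative (fun _ _ : unit => tt). Proof. by []. Qed.
Lemma unit_mul1 : left_id tt (fun _ _ : unit => tt). Proof. by case. Qed.
Lemma unit_mulr1 : right_id tt (fun _ _ : unit => tt). Proof. by case. Qed.

HB.instance Definition _ := isMonoid.Build unit unit_mulA unit_mul1 unit_mulr1.

Lemma cst1_monoid_morphism (M N : monoidType) :
  monoid_morphism (fun _ : M => 1 : N).
Proof. by split=> // x y; rewrite mulg1. Qed.

Definition cst1 (M N : monoidType) : M -> N := fun=> 1.
HB.instance Definition _ (M N : monoidType) :=
  isUMagmaMorphism.Build M N (@cst1 M N) (cst1_monoid_morphism M N).

Lemma ICMon_pointed : pointed ICMon.
Proof.
have uC (x y : unit) : x * y = y * x by [].
have uI (x : unit) : exists y : unit, x * y * x = x /\ y * x * y = y.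
  by exists tt; case: x.
exists (ICMonoid uC uI); split=> M.
  exists (@cst1 unit (M : icmon) : UMagmaMorphism.type _ _) => g.
  by apply: umagma_morphism_ext => -[]; exact: gmulf1.
exists (@cst1 (M : icmon) unit : UMagmaMorphism.type _ _) => g.
by apply: umagma_morphism_ext => x /=; case: (g x); case: (cst1 _ _).
Qed.

(* Main.v *)
Require Import Defs.
From HB Require Import structures.
From mathcomp Require Import all_boot.
From mathcomp Require Import boolp.

(** In a monoid an element x with x^n = 1, n > 0, is automatically a unit, so
    the elements of finite order of M form a subgroup t(M) of its group of
    units, and torsion-freeness of M means t(M) = {1}. In both torsion theories
    the torsion-free reflection is therefore the same quotient M/t(M), and only
    the torsion part depends on Z.

    Both classes Z define their trivial morphisms elementwise: a morphism is
    trivial iff all its values lie in a class N of null elements, where N = {1}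
    for the zero objects and N = {idempotents} for ECMon. The torsion part of M
    is then the submonoid N.t(M) of products of a null element and an element of
    finite order: it is t(M) when N = {1}, and E(M)t(M) when N consists of the
    idempotents E(M). That it is the kernel of the projection q rests on one
    lifting property: if q x is null, then x is in N.t(M). For idempotents, q x
    idempotent means x = x^2 u with u of finite order, and then e = x u is
    idempotent with x = e u^-1. That q is the cokernel of the inclusion holds
    because null elements are idempotent, while 1 is the only idempotent of
    finite order: a morphism with null values on N.t(M) kills t(M), and so
    factors through q. Finally, a morphism from a monoid equal to its torsion
    part to a torsion-free one sends elements of finite order to 1, so all its
    values are null.

    [null_class] isolates what is used of N, [null_torsion_theory] carries out
    this argument, and [zero_null_class] and [idempotent_null_class] provide the
    two instances. *)

Set Implicit Arguments.
Unset Strict Implicit.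
Unset Printing Implicit Defensive.

Import Algebra.

Local Open Scope group_scope.
Local Open Scope cat_scope.
Local Open Scope quotient_scope.

(** * Submonoids and quotients *)

Lemma icmon_homP (M N : icmon) (f : M -> N) :
  f 1 = 1 -> {morph f : x y / x * y} ->
  exists g : icmon_hom M N, forall x, g x = f x.
Proof.
move=> f1 fM.
pose mixin := isUMagmaMorphism.Build M N f (conj f1 fM).
pose g : UMagmaMorphism.type M N := HB.pack f mixin.
by exists g.
Qed.

(** Closure under inverses has to be required: a submonoid of an inverse monoid
    need not be inverse, as the natural numbers in the integers show. *)
Lemma icmon_submonoid (M : icmon) (P : M -> Prop) :
    P 1 -> (forall x y, P x -> P y -> P (x * y)) ->
    (forall x, P x -> exists y, [/\ P y, x * y * x = x & y * x * y = y]) ->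
  exists (A : icmon) (k : icmon_hom A M),
    injective k /\ forall x, P x <-> exists a, k a = x.
Proof.
move=> P1 PM PV.
pose S := {x : M | `[< P x >]}.
have Sval (a : S) : P (val a) by apply/asboolP/(valP a).
pose mk x (Px : P x) : S := exist _ x (asboolT Px).
pose mulS (a b : S) : S := mk _ (PM _ _ (Sval a) (Sval b)).
have mulSA : associative mulS by move=> a b c; apply/val_inj; exact: mulgA.
have mul1S : left_id (mk _ P1) mulS by move=> a; apply/val_inj; exact: mul1g.
have mulS1 : right_id (mk _ P1) mulS by move=> a; apply/val_inj; exact: mulg1.
pose mixin := isMonoid.Build S mulSA mul1S mulS1.
pose SM : monoidType := HB.pack S mixin.
have SC (x y : SM) : x * y = y * x by apply/val_inj; exact: icmon_mulC.
have SV (x : SM) : exists y : SM, x * y * x = x /\ y * x * y = y.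
  have [y [Py xyx yxy]] := PV _ (Sval x).
  by exists (mk _ Py); split; apply/val_inj.
have [k kE] := @icmon_homP (ICMonoid SC SV) M val erefl (fun _ _ => erefl).
exists (ICMonoid SC SV), k; split=> [a b|x].
  by rewrite !kE; exact: val_inj.
split=> [Px|[a <-]]; first by exists (mk _ Px); rewrite kE.
by rewrite kE; exact: Sval.
Qed.

(** The classes are the cosets xU: since U is a group of units, being in the
    same coset is an equivalence relation, and commutativity makes it a
    congruence. *)
Lemma icmon_quotient (M : icmon) (U : M -> Prop) :
    U 1 -> (forall u v, U u -> U v -> U (u * v)) ->
    (forall u, U u -> exists2 v, U v & u * v = 1) ->
  exists (B : icmon) (q : icmon_hom M B),
    (forall b, exists x, q x = b) /\
    forall x y, q x = q y <-> exists2 u, U u & y = x * u.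
Proof.
move=> U1 UM UV.
pose e : rel M := fun x y => `[< exists2 u, U u & y = x * u >].
have e_refl : reflexive e by move=> x; apply/asboolP; exists 1; rewrite ?mulg1.
have e_imp x y : e x y -> e y x.
  case/asboolP=> u /UV[v Uv uv1] ->; apply/asboolP.
  by exists v; rewrite // -mulgA uv1 mulg1.
have e_sym : symmetric e by move=> x y; apply/idP/idP; exact: e_imp.
have e_trans : transitive e.
  move=> y x z /asboolP[u Uu ->] /asboolP[v Uv ->]; apply/asboolP.
  by exists (u * v); [exact: UM | rewrite mulgA].
pose eR := EquivRel e e_refl e_sym e_trans.
pose Q := {eq_quot eR}.
have piP x y : \pi_Q x = \pi_Q y <-> exists2 u, U u & y = x * u.
  split=> [/eqmodP/asboolP //|H]; apply/eqmodP; exact/asboolP.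
have [mulQ piM] : exists mulQ : Q -> Q -> Q,
    forall x y, \pi_Q (x * y) = mulQ (\pi_Q x) (\pi_Q y).
  exists (fun a b => \pi_Q (repr a * repr b)) => x y.
  have [u Uu xE] := (piP x (repr (\pi_Q x))).1 (esym (reprK _)).
  have [v Uv yE] := (piP y (repr (\pi_Q y))).1 (esym (reprK _)).
  apply/piP; exists (u * v); first exact: UM.
  rewrite xE yE !mulgA; congr (_ * _); rewrite -!mulgA; congr (_ * _).
  exact: icmon_mulC.
have mulQA : associative mulQ.
  move=> a b c; rewrite -(reprK a) -(reprK b) -(reprK c).
  by rewrite -!piM mulgA.
have mul1Q : left_id (\pi_Q 1) mulQ.
  by move=> a; rewrite -(reprK a) -piM mul1g.
have mulQ1 : right_id (\pi_Q 1) mulQ.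
  by move=> a; rewrite -(reprK a) -piM mulg1.
have mulQC : commutative mulQ.
  by move=> a b; rewrite -(reprK a) -(reprK b) -!piM icmon_mulC.
have mulQV a : exists b, mulQ (mulQ a b) a = a /\ mulQ (mulQ b a) b = b.
  have [y [xyx yxy]] := icmon_inverse (repr a).
  by exists (\pi_Q y); rewrite -(reprK a) -!piM xyx yxy.
pose mixin := isMonoid.Build Q mulQA mul1Q mulQ1.
pose QM : monoidType := HB.pack Q mixin.
have QC : forall a b : QM, a * b = b * a := mulQC.
have QV : forall a : QM, exists b : QM, a * b * a = a /\ b * a * b = b := mulQV.
have [q qE] := @icmon_homP M (ICMonoid QC QV) (fun x => \pi_Q x) erefl piM.
exists (ICMonoid QC QV), q; split=> [b|x y].
  by exists (repr (b : Q)); rewrite qE; exact: (reprK (b : Q)).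
by rewrite !qE; exact: piP.
Qed.

Lemma factor_injective (A M X : icmon) (k : icmon_hom A M)
    (x : icmon_hom X M) :
    injective k -> (forall z, exists a, k a = x z) ->
  exists! x' : icmon_hom X A, x = icmon_comp k x'.
Proof.
move=> k_inj /choice[f fE].
have [||g gE] := @icmon_homP X A f.
- by apply: k_inj; rewrite fE !gmulf1.
- by move=> z t; apply: k_inj; rewrite fE !gmulfM !fE.
exists g; split=> [|h xE]; apply: umagma_morphism_ext => z.
  by rewrite /= gE fE.
by apply: k_inj; rewrite gE fE xE.
Qed.

Lemma factor_surjective (M B X : icmon) (q : icmon_hom M B)
    (h : icmon_hom M X) :
    (forall b, exists x, q x = b) -> (forall x y, q x = q y -> h x = h y) ->
  exists! h' : icmon_hom B X, h = icmon_comp h' q.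
Proof.
move=> /choice[s sK] qh.
have [||g gE] := @icmon_homP B X (h \o s).
- by rewrite /= -(@gmulf1 _ _ h); apply: qh; rewrite sK gmulf1.
- by move=> b c /=; rewrite -gmulfM; apply: qh; rewrite gmulfM !sK.
exists g; split=> [|g' hE]; apply: umagma_morphism_ext => x.
  by rewrite /= gE; apply: qh; rewrite sK.
by rewrite gE /= hE /= sK.
Qed.

(** * Elements of finite order *)

Definition torsion (M : monoidType) (x : M) : Prop :=
  exists2 n, (0 < n)%N & x ^+ n = 1.

Lemma torsion1 (M : monoidType) : torsion (1 : M).
Proof. by exists 1%N; rewrite ?expg1. Qed.

Lemma torsionM (M : icmon) (x y : M) :
  torsion x -> torsion y -> torsion (x * y).
Proof.
move=> [m m_gt0 xm1] [n n_gt0 yn1]; exists (m * n)%N.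
  by rewrite muln_gt0 m_gt0.
rewrite expgMn; last exact: icmon_mulC.
by rewrite expgnA xm1 mulnC expgnA yn1 !expg1n mulg1.
Qed.

Lemma torsionV (M : monoidType) (x : M) :
  torsion x -> exists2 y, torsion y & x * y = 1.
Proof.
move=> [n n_gt0 xn1]; exists (x ^+ n.-1); last by rewrite -expgS prednK.
by exists n; rewrite // -expgnA mulnC expgnA xn1 expg1n.
Qed.

Lemma torsion_root (M : monoidType) (x : M) n :
  (0 < n)%N -> torsion (x ^+ n) -> torsion x.
Proof.
move=> n_gt0 [m m_gt0 xnm1]; exists (n * m)%N; first by rewrite muln_gt0 n_gt0.
by rewrite expgnA.
Qed.

Lemma torsion_hom (M N : icmon) (f : icmon_hom M N) x :
  torsion x -> torsion (f x).
Proof. by move=> [n n_gt0 xn1]; exists n; rewrite // -gmulfXn xn1 gmulf1. Qed.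

Lemma torsion_injective (M N : icmon) (f : icmon_hom M N) x :
  injective f -> torsion (f x) -> torsion x.
Proof.
move=> f_inj [n n_gt0 fxn1]; exists n => //.
by apply: f_inj; rewrite gmulfXn fxn1 gmulf1.
Qed.

(** An element of finite order is a unit, and 1 is the only idempotent unit. *)
Lemma torsion_idem (M : monoidType) (x : M) : torsion x -> x * x = x -> x = 1.
Proof.
by move=> /torsionV[y _ xy1] xx; rewrite -xy1 -{2}xx -mulgA xy1 mulg1.
Qed.

(** For q surjective, this characterises q as the projection of M onto its
    quotient by the group of elements of finite order. *)
Definition torsion_kernel (M B : icmon) (q : icmon_hom M B) : Prop :=
  forall x y, q x = q y <-> exists2 u, torsion u & y = x * u.

Lemma torsion_quotient (M : icmon) :
  exists (B : icmon) (q : icmon_hom M B),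
    (forall b, exists x, q x = b) /\ torsion_kernel q.
Proof. exact: icmon_quotient (torsion1 M) (@torsionM M) (@torsionV M). Qed.

(** If x^n has finite order then so does x, hence nothing new becomes torsion in
    the quotient. *)
Lemma torsion_quotient_free (M B : icmon) (q : icmon_hom M B) :
  (forall b, exists x, q x = b) -> torsion_kernel q -> torsion_free_monoid B.
Proof.
move=> q_surj qP b n n_gt0; have [x <-] := q_surj b.
rewrite -gmulfXn -(@gmulf1 _ _ q) => /esym/qP[u tu]; rewrite mul1g => xnE.
have tx : torsion x by apply: torsion_root n_gt0 _; rewrite xnE.
by apply/esym/qP; exists x; rewrite ?mul1g.
Qed.

(** * The torsion theory attached to a class of null elements *)

Definition null_torsion (N : forall M : icmon, M -> Prop) (M : icmon) (x : M) :=
  exists e u, [/\ N M e, torsion u & x = e * u].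

(** The requirements under which the submonoids of null-torsion elements give a
    torsion theory relative to Z. [Ztrivial_null] turns the universal properties
    into conditions on elements; [null_lift] is what makes the null-torsion
    elements the kernel of the projection q. *)
Record null_class (Z : full_replete_subcategory ICMon)
    (N : forall M : icmon, M -> Prop) : Prop := NullClass {
  null1 : forall M : icmon, N M 1;
  nullM : forall (M : icmon) (x y : M), N M x -> N M y -> N M (x * y);
  null_idem : forall (M : icmon) (x : M), N M x -> x * x = x;
  null_hom : forall (M B : icmon) (f : icmon_hom M B) x, N M x -> N B (f x);
  null_injective : forall (M B : icmon) (f : icmon_hom M B) x,
    injective f -> N B (f x) -> N M x;
  null_lift : forall (M B : icmon) (q : icmon_hom M B) x,
    torsion_kernel q -> N B (q x) -> null_torsion N x;
  Ztrivial_null : forall (A B : ICMon) (f : hom A B),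
    Ztrivial Z f <-> forall x : (A : icmon), N B ((f : icmon_hom A B) x) }.

Section NullClass.

Variables (Z : full_replete_subcategory ICMon).
Variables (N : forall M : icmon, M -> Prop) (ZN : null_class Z N).

Lemma null_torsion_replete (A B : ICMon) :
  isomorphic A B -> (forall x : (A : icmon), null_torsion N x) ->
  forall x : (B : icmon), null_torsion N x.
Proof.
move=> /ICMon_iso[f [g [_ gK]]] AT x.
have [e [u [Ne tu xE]]] := AT (g x).
exists (f e), (f u); split; [exact: (null_hom ZN) | exact: torsion_hom |].
by rewrite -gmulfM -xE gK.
Qed.

Definition null_torsion_monoids : full_replete_subcategory ICMon :=
  FullRepleteSubcategory null_torsion_replete.

Lemma null_torsion_submonoid (M : icmon) :
  exists (A : icmon) (k : icmon_hom A M),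
    injective k /\ forall x, null_torsion N x <-> exists a, k a = x.
Proof.
apply: icmon_submonoid.
- exists 1, 1; split; [exact: (null1 ZN) | exact: torsion1 | by rewrite mulg1].
- move=> _ _ [e [u [Ne tu ->]]] [e' [u' [Ne' tu' ->]]].
  exists (e * e'), (u * u').
  split; [exact: (nullM ZN) | exact: torsionM |].
  rewrite !mulgA; congr (_ * _); rewrite -!mulgA; congr (_ * _).
  exact: icmon_mulC.
- move=> _ [e [u [Ne tu ->]]]; have [v tv uv1] := torsionV tu.
  exists (e * v); have ee := null_idem ZN Ne.
  (* An idempotent is its own inverse, so e v is an inverse of e u. *)
  have evu (s t : M) : s * t = 1 -> e * s * (e * t) * (e * s) = e * s.
    move=> st1; rewrite -[e * s * _]mulgA [s * _]mulgA (icmon_mulC s e).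
    by rewrite -[e * s * t]mulgA st1 mulg1 ee mulgA ee.
  split; [by exists e, v | exact: evu | by apply: evu; rewrite icmon_mulC].
Qed.

(** The exact sequence of X is null_torsion(X) -> X -> X/t(X). *)
Lemma null_torsion_theory : Ztorsion_theory Z null_torsion_monoids TFICMon.
Proof.
split=> [A B f AT BF|X].
  apply/(Ztrivial_null ZN) => x; have [e [u [Ne tu ->]]] := AT x.
  have [n n_gt0 fun1] := torsion_hom f tu.
  by rewrite gmulfM (BF _ n n_gt0 fun1) mulg1; exact: (null_hom ZN).
have [A [k [k_inj kP]]] := null_torsion_submonoid X.
have [B [q [q_surj qP]]] := torsion_quotient X.
have q_torsion u : torsion u -> q u = 1.
  move=> tu; rewrite -(@gmulf1 _ _ q); apply/esym/qP.
  by exists u; rewrite ?mul1g.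
have qk_trivial : Ztrivial Z ((q : hom (X : ICMon) (B : ICMon)) \oc k).
  apply/(Ztrivial_null ZN) => a /=.
  have [e [u [Ne tu ->]]] := (kP (k a)).2 (ex_intro _ a erefl).
  by rewrite gmulfM (q_torsion u) // mulg1; exact: (null_hom ZN).
exists A, B, k, q; split.
(* The two factors of k a = e u are themselves null-torsion elements of X, so
   the decomposition takes place inside A. *)
- move=> a; have [e [u [Ne tu kaE]]] := (kP (k a)).2 (ex_intro _ a erefl).
  have [|e' e'E] := (kP e).1.
    by exists e, 1; rewrite mulg1; split=> //; exact: torsion1.
  have [|u' u'E] := (kP u).1.
    by exists 1, u; rewrite mul1g; split=> //; exact: (null1 ZN).
  exists e', u'; split.
  + by apply: (null_injective ZN) k_inj _; rewrite e'E.
  + by apply: torsion_injective k_inj _; rewrite u'E.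
  + by apply: k_inj; rewrite gmulfM e'E u'E.
- exact: torsion_quotient_free q_surj qP.
- split; split=> // Y h.
    move=> /(Ztrivial_null ZN) qhN; apply: factor_injective => // z.
    exact/kP/(null_lift ZN qP)/qhN.
  (* h u is null, hence idempotent, and of finite order, hence equal to 1. *)
  move=> /(Ztrivial_null ZN) hkN; apply: factor_surjective => // x y.
  move=> /qP[u tu ->]; rewrite gmulfM.
  have [|a aE] := (kP u).1.
    by exists 1, u; rewrite mul1g; split=> //; exact: (null1 ZN).
  rewrite (torsion_idem (torsion_hom h tu)) ?mulg1 // -aE.
  exact: (null_idem ZN) (hkN a).
Qed.

End NullClass.

(** * The two classes of trivial objects *)

(** On a zero object the identity and the constant morphism 1 coincide. *)
Lemma zero_object_eq1 (O : ICMon) (x : (O : icmon)) : is_zero_object O -> x = 1.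
Proof.
case=> _ /(_ O)[h hP].
pose one : icmon_hom O O :=
  @cst1 (O : icmon) (O : icmon) : UMagmaMorphism.type _ _.
have id_one : icmon_id O = one := etrans (hP (idm O)) (esym (hP one)).
by rewrite -[LHS]/(icmon_id O x) id_one.
Qed.

Lemma zero_null_class :
  null_class (zero_objects ICMon) (fun (M : icmon) (x : M) => x = 1).
Proof.
split=> //.
- by move=> M x y -> ->; rewrite mulg1.
- by move=> M x ->; rewrite mulg1.
- by move=> M B f x ->; rewrite gmulf1.
- by move=> M B f x f_inj fx1; apply: f_inj; rewrite fx1 gmulf1.
- move=> M B q x qP; rewrite -(@gmulf1 _ _ q) => /esym/qP[u tu ->].
  by exists 1, u.
move=> A B f; split=> [[O [p [q [O0 ->]]]] x|f1].
  by rewrite /= (zero_object_eq1 (p x) O0) gmulf1.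
have [O O0] := ICMon_pointed; have [iO tO] := O0.
have [p _] := tO A; have [q _] := iO B.
exists O, p, q; split=> //.
apply: umagma_morphism_ext => x /=.
by rewrite (zero_object_eq1 (p x) O0) gmulf1 f1.
Qed.

Lemma idempotent_null_class :
  null_class ECMon (fun (M : icmon) (x : M) => x * x = x).
Proof.
have idemM (M : icmon) (x y : M) :
    x * x = x -> y * y = y -> x * y * (x * y) = x * y.
  move=> xx yy; rewrite -mulgA [y * _]mulgA (icmon_mulC y x).
  by rewrite -[x * y * y]mulgA yy mulgA xx.
split=> //.
- by move=> M; rewrite mulg1.
- by move=> M B f x xx; rewrite -gmulfM xx.
- by move=> M B f x f_inj fxx; apply: f_inj; rewrite gmulfM.
- move=> M B q x qP; rewrite -gmulfM => /qP[u tu xE].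
  have [v tv uv1] := torsionV tu.
  (* From x = x^2 u the element x u is idempotent, and x = (x u) u^-1. *)
  exists (x * u), v; split=> //; last by rewrite -mulgA uv1 mulg1.
  by rewrite -mulgA [u * _]mulgA (icmon_mulC u x) !mulgA -xE.
move=> A B f; split=> [[O [p [q [O_idem ->]]]] x|f_idem].
  by rewrite /= -gmulfM O_idem.
(* A morphism with idempotent values factors through the idempotents of its
   codomain. *)
have [|||O [k [k_inj kP]]] := @icmon_submonoid B (fun x => x * x = x).
- by rewrite mulg1.
- exact: idemM.
- by move=> x xx; exists x; rewrite !xx.
have [|p [fE _]] := @factor_injective O B A k f k_inj.
  by move=> x; apply/kP.
exists O, p, k; split=> // x; apply: k_inj.
by rewrite gmulfM; apply/kP; exists x.
Qed.

Theorem proposition7p4 :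
  Ztorsion_free (zero_objects ICMon) TFICMon /\ Ztorsion_free ECMon TFICMon.
Proof.
split.
  exists (null_torsion_monoids zero_null_class).
  exact: null_torsion_theory.
exists (null_torsion_monoids idempotent_null_class).
exact: null_torsion_theory.
Qed.
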